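(* Let $H$ be a finite nonempty undirected graph (loops allowed, no multiple edges) in which every vertex is incident to at least one edge (possibly a loop), and let $u$ be a function assigning a positive real weight to each vertex of $H$. Let $R$ be the transition matrix of the random walk on $H$ defined by $$R_{i,j}=\frac{u(j)}{\sum_{il\in E(H)}u(l)}\,[ij\in E(H)] .$$ Let $\pi$ be the distribution on $V(H)$ defined by $$\pi_i=\frac{u(i)\sum_{il\in E(H)}u(l)}{C},\qquad C=\sum_{x\in V(H)}u(x)\sum_{xy\in E(H)}u(y).$$ Then $\pi$ is a stationary distribution in detailed balance with $R$ (that is, $\pi_iR_{i,j}=\pi_jR_{j,i}$ for all vertices $i,j$), and the random walk is reversible and diagonalisable (that is, its transition matrix $R$ is diagonalisable).
   Context: $V(H)$ and $E(H)$ are the vertex and edge sets of $H$. A sum $\sum_{il\in E(H)}$ with $i$ fixed is over all vertices $l$ adjacent to $i$ (including $l=i$, counted once, if there is a loop at $i$). $[\,\cdot\,]$ is the Iverson bracket, equal to $1$ if the enclosed statement is true and $0$ otherwise. *)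

(* Defs.v *)
From HB Require Import structures.
From mathcomp Require Import all_boot all_order all_algebra.
From mathcomp Require Import reals.

Set Implicit Arguments.
Unset Strict Implicit.
Unset Printing Implicit Defensive.

Import Order.TTheory GRing.Theory Num.Theory.
Local Open Scope ring_scope.

(* A finite undirected graph without multiple edges is a finType V with a     *)
(* symmetric relation adj; irreflexivity is not assumed, so adj i i is a loop *)
(* at i.                                                                      *)

Section WeightedWalk.
Variables (R : realType) (V : finType) (adj : rel V) (u : V -> R).

(* A loop at i contributes the single term u i. *)
Definition nbr_weight (i : V) : R := \sum_(l | adj i l) u l.

Definition walk (i j : V) : R := u j / nbr_weight i * (adj i j)%:R.

Definition walk_norm : R := \sum_x u x * nbr_weight x.

Definition walk_dist (i : V) : R := u i * nbr_weight i / walk_norm.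

End WeightedWalk.

Section FiniteChain.
Variables (R : realType) (V : finType).
Implicit Types (P : V -> V -> R) (mu : V -> R).

Definition distribution mu : Prop :=
  (forall i, 0 <= mu i) /\ \sum_i mu i = 1.

Definition transition P : Prop := forall i, distribution (P i).

Definition stationary_distribution P mu : Prop :=
  distribution mu /\ forall j, \sum_i mu i * P i j = mu j.

Definition detailed_balance P mu : Prop :=
  forall i j, mu i * P i j = mu j * P j i.

(* Positivity of mu matters when the chain is reducible: otherwise mu could   *)
(* be supported on one part of the state space and the condition would say    *)
(* nothing about the rest.                                                    *)
Definition reversible P : Prop :=
  transition P /\
  exists mu, [/\ forall i, 0 < mu i,
                 stationary_distribution P mu
               & detailed_balance P mu].

(* MathComp matrices are indexed by ordinals, so the states are enumerated.   *)
Definition kernel_mx P : 'M[R]_#|V| :=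
  \matrix_(i, j) P (enum_val i) (enum_val j).

End FiniteChain.

(* Main.v *)
Require Import Defs.
From HB Require Import structures.
From mathcomp Require Import all_boot all_order all_algebra.
From mathcomp Require Import complex.
From mathcomp Require Import reals.

(** Detailed balance is immediate: both [walk_dist i * walk i j] and
    [walk_dist j * walk j i] equal [u i * u j / walk_norm] when [i] and [j] are
    adjacent, and vanish otherwise ([walk_detailed_balance]). Summing detailed
    balance over one endpoint gives stationarity
    ([detailed_balance_stationary]). Since no vertex is isolated, every
    neighbourhood weight is positive, so the stationary distribution charges
    every vertex.

    For diagonalisability, let [D] be the diagonal matrix of the square roots of
    a positive reversing measure. Detailed balance for a kernel [K] says exactly
    that [D K D^-1] is symmetric ([reversible_diagonalizable]), so everything
    reduces to the spectral theorem for real symmetric matrices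
    ([symmetric_diagonalizable]). That theorem is derived from the complex one:
    a real symmetric matrix is Hermitian over the complex numbers, hence its
    minimal polynomial is a product of distinct linear factors with real roots;
    minimal polynomials do not change under field extension, so the same
    factorisation holds over the reals. *)

Set Implicit Arguments.
Unset Strict Implicit.
Unset Printing Implicit Defensive.

Import Order.TTheory GRing.Theory Num.Theory.
Local Open Scope ring_scope.

(** Diagonalisability over a smaller field is read off the minimal polynomial,
    which, unlike the diagonalising basis, descends along a field extension. *)
Lemma diagonalizable_descent (F K : fieldType) (f : {rmorphism F -> K}) (n : nat)
    (A : 'M[F]_n) (P : 'M[K]_n) (d : 'rV[F]_n) :
  P \in unitmx -> map_mx f A = invmx P *m diag_mx (map_mx f d) *m P ->
  diagonalizable A.
Proof.
case: n A P d => [|n] A P d Punit Afd.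
  by rewrite [A]flatmx0; apply: diagonalizable0.
pose rs := undup [seq d 0 i | i <- enum 'I_n.+1].
apply/diagonalizableP; exists rs; first exact: undup_uniq.
rewrite -(mxminpoly_diag d) -(dvdp_map f) -!mxminpoly_map map_diag_mx.
suff -> : mxminpoly (map_mx f A) = mxminpoly (diag_mx (map_mx f d)) by [].
by rewrite Afd -conjVmx// mxminpoly_uconj ?unitmx_inv.
Qed.

Lemma symmetric_diagonalizable (R : rcfType) (n : nat) (A : 'M[R]_n) :
  A^T = A -> diagonalizable A.
Proof.
move=> Asym; pose AC := map_mx (real_complex R) A.
have AC_herm : AC \is hermsymmx.
  apply/is_hermitianmxP; rewrite expr0 scale1r map_trmx Asym.
  by apply/matrixP => i j; rewrite !mxE; apply/esym/CrealP/complex_realP; eexists.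
have /mxOverP d_real := hermitian_spectral_diag_real AC_herm.
have /orthomx_spectralP := hermitian_normalmx AC_herm.
suff -> : spectral_diag AC =
    map_mx (real_complex R) (map_mx (@complex.Re R) (spectral_diag AC)).
  exact/diagonalizable_descent/spectral_unit.
by apply/matrixP => i j; rewrite !mxE RRe_real.
Qed.

Lemma similar_diagonalizable (F : fieldType) (n : nat) (P A B : 'M[F]_n) :
  P \in unitmx -> similar P A B -> diagonalizable B -> diagonalizable A.
Proof.
move=> Punit /eqP <- [Q Qunit QB]; exists (Q *m P).
  by rewrite unitmx_mul Qunit.
by rewrite /similar_to conjMumx ?row_free_unit ?stablemx_unit.
Qed.

Section FiniteChains.
Variables (R : realType) (V : finType).
Implicit Types (P : V -> V -> R) (mu : V -> R).

Lemma detailed_balance_stationary P mu :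
  transition P -> distribution mu -> detailed_balance P mu ->
  stationary_distribution P mu.
Proof.
move=> Ptr mu_distr Pmu; split=> // j.
under eq_bigr do rewrite Pmu.
by rewrite -mulr_sumr (Ptr j).2 mulr1.
Qed.

(** A kernel in detailed balance with [mu] is self-adjoint for the inner product
    with weights [mu]; conjugating by the square roots of the weights turns this
    into a symmetric matrix. *)
Lemma reversible_diagonalizable P mu :
  (forall i, 0 < mu i) -> detailed_balance P mu -> diagonalizable (kernel_mx P).
Proof.
move=> mu_gt0 Pmu.
pose s i := Num.sqrt (mu i).
have s_neq0 i : s i != 0 by rewrite gt_eqF ?sqrtr_gt0.
have sqr_s i : s i * s i = mu i by rewrite -expr2 sqr_sqrtr ?ltW.
pose D : 'M[R]_#|V| := diag_mx (\row_j s (enum_val j)).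
have Dunit : D \in unitmx.
  rewrite unitmxE det_diag unitfE; apply/prodf_neq0 => i _.
  by rewrite mxE.
pose S := kernel_mx (fun i j => s i * P i j / s j).
apply: (@similar_diagonalizable _ _ D _ S) => //.
  apply/similarP => //; apply/matrixP => i j.
  by rewrite mul_diag_mx mul_mx_diag !mxE divfK.
apply: symmetric_diagonalizable; apply/matrixP => i j; rewrite !mxE.
move: (enum_val i) (enum_val j) => x y.
apply/eqP; rewrite eqr_div// -mulrA [P y x * _]mulrC mulrA sqr_s.
by rewrite -[X in _ == X]mulrA [P x y * _]mulrC mulrA sqr_s Pmu.
Qed.

End FiniteChains.

Section WeightedWalks.
Variables (R : realType) (V : finType) (adj : rel V) (u : V -> R).
Hypothesis u_pos : forall i, 0 < u i.

Lemma nbr_weight_gt0 i : (exists j, adj i j) -> 0 < nbr_weight adj u i.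
Proof.
move=> [j adj_ij]; rewrite /nbr_weight (bigD1 j)//=.
by rewrite ltr_pwDl// sumr_ge0// => l _; apply: ltW.
Qed.

Hypothesis no_isolated : forall i, exists j, adj i j.

Lemma walk_transition : transition (walk adj u).
Proof.
move=> i; have w_gt0 := nbr_weight_gt0 (no_isolated i); split=> [j|].
  by rewrite mulr_ge0 ?ler0n// divr_ge0// ltW.
under eq_bigr do rewrite /walk mulr_natr mulrb.
by rewrite -big_mkcond -mulr_suml divff ?gt_eqF.
Qed.

Hypothesis V_nonempty : (0 < #|V|)%N.

Lemma walk_norm_gt0 : 0 < walk_norm adj u.
Proof.
have uw_gt0 x : 0 < u x * nbr_weight adj u x.
  by rewrite mulr_gt0 ?nbr_weight_gt0.
have /card_gt0P[x0 _] := V_nonempty; rewrite /walk_norm (bigD1 x0)//=.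
by rewrite ltr_pwDl// sumr_ge0// => x _; apply: ltW.
Qed.

Lemma walk_dist_gt0 i : 0 < walk_dist adj u i.
Proof. by rewrite divr_gt0 ?walk_norm_gt0// mulr_gt0 ?nbr_weight_gt0. Qed.

Lemma walk_dist_distribution : distribution (walk_dist adj u).
Proof.
split=> [i|]; first exact/ltW/walk_dist_gt0.
by rewrite -mulr_suml divff// gt_eqF ?walk_norm_gt0.
Qed.

Hypothesis adj_sym : symmetric adj.

(** The neighbourhood weight in [walk_dist] cancels the denominator of [walk],
    leaving an expression symmetric in the two vertices. *)
Lemma walk_detailed_balance : detailed_balance (walk adj u) (walk_dist adj u).
Proof.
have flow x y :
    walk_dist adj u x * walk adj u x y = u x * u y / walk_norm adj u * (adj x y)%:R.
  have w_neq0 : nbr_weight adj u x != 0 by rewrite gt_eqF ?nbr_weight_gt0.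
  rewrite /walk_dist /walk mulrA; congr (_ * _).
  by rewrite mulrAC mulrACA divff// mulr1.
by move=> i j; rewrite !flow adj_sym [u i * _]mulrC.
Qed.

End WeightedWalks.

Theorem lemma5p4 (R : realType) (V : finType) (adj : rel V) (u : V -> R)
  (V_nonempty : (0 < #|V|)%N)
  (adj_sym : symmetric adj)
  (no_isolated : forall i, exists j, adj i j)
  (u_pos : forall i, 0 < u i) :
  [/\ stationary_distribution (walk adj u) (walk_dist adj u),
      detailed_balance (walk adj u) (walk_dist adj u),
      reversible (walk adj u)
    & diagonalizable (kernel_mx (walk adj u))].
Proof.
have balance := walk_detailed_balance u_pos no_isolated adj_sym.
have dist_gt0 := walk_dist_gt0 u_pos no_isolated V_nonempty.
have trans := walk_transition u_pos no_isolated.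
have stat := detailed_balance_stationary trans
  (walk_dist_distribution u_pos no_isolated V_nonempty) balance.
split=> //.
- by split=> //; exists (walk_dist adj u).
- exact: reversible_diagonalizable dist_gt0 balance.
Qed.
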